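(* The strong cop number of Thompson's group $F$ is infinite, i.e. $\operatorname{sCop}(F)=\infty$.
   Context: Thompson's group $F$ is the (finitely generated) group of orientation-preserving piecewise linear homeomorphisms of $[0,1]$ with finitely many breakpoints, all at dyadic rationals, and all slopes powers of $2$. Convention: $\mathbb{N}=\mathbb{Z}_{\geq 1}$. Graphs are connected, undirected, without double edges or loops, with the path metric on vertices. Game. Let $\Gamma$ be a graph. The cops and robbers game on $\Gamma$ has parameters: number of cops $n\in\mathbb{N}$, base point (treasure) $v\in\Gamma$ a vertex, cop speed $\sigma\in\mathbb{N}$, robber speed $\psi\in\mathbb{N}$, cop reach $\rho\in\mathbb{N}$, robber radius $R\in\mathbb{N}$. It is a two-player game with perfect information. First the cop player chooses $n$ vertices as starting positions of the cops, then the robber chooses a vertex as starting position. The players then alternate turns, starting with the cops. In each turn the cop player may move each cop along a path of length at most $\sigma$ to some vertex; then the robber moves along a path of length at most $\psi$ ending in a vertex. One cop move followed by one robber move is a stage. The cop player wins if the robber is captured, i.e. at some time during some stage the robber's position is at distance at most $\rho$ from some cop's position (this includes every vertex traversed by the robber during a move: the robber must traverse the path edge by edge without ever coming within distance $\rho$ of a cop), or if the cops eventually defend $v$, i.e. after some finite initial time the robber never enters the closed ball of radius $R$ around $v$. Otherwise the robber wins. The strong cop number $\operatorname{sCop}(\Gamma)\in\mathbb{N}\cup\{\infty\}$ is the infimum (with $\inf\emptyset=\infty$) of all $n\in\mathbb{N}$ such that $\forall v\in\Gamma,\ \exists\sigma\in\mathbb{N},\ \forall\psi\in\mathbb{N},\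 \exists\rho\in\mathbb{N},\ \forall R\in\mathbb{N}$: the cop player has a winning strategy with $n$ cops. This number is invariant under quasi-isometry, so for a finitely generated group $G$ one sets $\operatorname{sCop}(G):=\operatorname{sCop}(\operatorname{Cay}(G,S))$ for any finite generating set $S$. *)

(* Defs.v *)
From HB Require Import structures.
From mathcomp Require Import all_boot all_order all_algebra.
From mathcomp Require Import all_classical all_reals all_analysis.
Set Implicit Arguments.
Unset Strict Implicit.
Unset Printing Implicit Defensive.
Import Order.TTheory GRing.Theory Num.Theory.
Import numFieldNormedType.Exports.

Local Open Scope classical_set_scope.
Local Open Scope ring_scope.

Record graph : Type := Graph {
  vertex :> Type;
  adj : rel vertex;
  adj_sym : symmetric adj;
  adj_irr : irreflexive adj;
  adj_connected : forall x y : vertex,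
    exists p : seq vertex, path adj x p /\ last x p = y
}.

Section Dist.
Variable G : graph.
Implicit Types x y : G.

Lemma walk_length_ex x y :
  exists k, `[< exists p : seq G,
    [/\ path (@adj G) x p, last x p = y & size p = k] >].
Proof.
by have [p [px py]] := adj_connected x y; exists (size p); apply/asboolP; exists p.
Qed.

Definition dist x y : nat := ex_minn (walk_length_ex x y).

End Dist.

Section Game.
Variables (G : graph) (n : nat).

(* [p] lists the vertices traversed when leaving [x], the starting vertex [x]
   itself being omitted; [p = [::]] means staying at [x]. *)
Definition legal_move (speed : nat) (x : G) (p : seq G) : Prop :=
  path (@adj G) x p /\ (size p <= speed)%N.

(* The moves of a cop strategy may depend on the whole past of the play, that
   is, on the starting vertex of the robber and the list of all the moves made
   by the robber so far, in chronological order; the past moves of the cops are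
   determined by this data and by the strategy. *)
Record cop_strategy : Type := CopStrategy {
  cop_start : 'I_n -> G;
  cop_move : G -> seq (seq G) -> 'I_n -> seq G
}.

Section Play.
Variables (S : cop_strategy) (r0 : G) (w : nat -> seq G).

(* Stages are numbered from 0; [robber_pos t] and [cop_pos t] are the
   positions at the beginning of stage [t]; in stage [t] the cop [i] moves
   along [cop_walk t i] and then the robber moves along [w t]. *)
Fixpoint robber_pos (t : nat) : G :=
  if t is t'.+1 then last (robber_pos t') (w t') else r0.

Definition cop_walk (t : nat) : 'I_n -> seq G := cop_move S r0 (mkseq w t).

Fixpoint cop_pos (t : nat) (i : 'I_n) : G :=
  if t is t'.+1 then last (cop_pos t' i) (cop_walk t' i) else cop_start S i.

(* The robber stands still while the cops move and conversely; all the vertices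
   traversed by either side during a stage are taken into account. *)
Definition captured (rho : nat) : Prop :=
  exists (t : nat) (i : 'I_n),
    has (fun c => (dist c (robber_pos t) <= rho)%N) (cop_pos t i :: cop_walk t i)
    \/ has (fun r => (dist (cop_pos t.+1 i) r <= rho)%N) (robber_pos t :: w t).

Definition defended (v : G) (R : nat) : Prop :=
  exists T : nat, forall t : nat, (T <= t)%N ->
    all (fun r => (R < dist v r)%N) (robber_pos t :: w t).

End Play.

Definition winning (v : G) (sigma psi rho R : nat) (S : cop_strategy) : Prop :=
  forall (r0 : G) (w : nat -> seq G),
    (forall t, legal_move psi (robber_pos r0 w t) (w t)) ->
    (forall t i, legal_move sigma (cop_pos S r0 w t i) (cop_walk S r0 w t i))
    /\ (captured S r0 w rho \/ defended r0 w v R).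

End Game.

Definition strong_cop_win (G : graph) (n : nat) : Prop :=
  forall v : G, exists2 sigma : nat, (0 < sigma)%N &
  forall psi : nat, (0 < psi)%N -> exists2 rho : nat, (0 < rho)%N &
  forall R : nat, (0 < R)%N ->
    exists S : cop_strategy G n, winning v sigma psi rho R S.

(* [ereal_inf set0 = +oo]. *)
Definition sCop (R : realType) (G : graph) : \bar R :=
  ereal_inf [set n%:R%:E | n in [set n : nat | (0 < n)%N /\ strong_cop_win G n]].

Definition generates (gT : groupType) (S : seq gT) : Prop :=
  forall H : {pred gT}, group_closed H -> {subset S <= H} -> forall g, g \in H.

Section Cayley.
Local Open Scope group_scope.
Variables (gT : groupType) (S : seq gT).

Definition cayley_adj : rel gT := fun g h =>
  (g != h) && ((g^-1 * h \in S) || (h^-1 * g \in S)).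

Lemma cayley_adj_sym : symmetric cayley_adj.
Proof. by move=> g h; rewrite /cayley_adj eq_sym orbC. Qed.

Lemma cayley_adj_irr : irreflexive cayley_adj.
Proof. by move=> g; rewrite /cayley_adj eqxx. Qed.

Hypothesis genS : generates S.

Let conn (x y : gT) := exists p, path cayley_adj x p /\ last x p = y.

Let conn_trans x y z : conn x y -> conn y z -> conn x z.
Proof.
move=> [p [px <-]] [q [qy <-]]; exists (p ++ q).
by rewrite cat_path px qy last_cat.
Qed.

Let conn1 x y : (x^-1 * y \in S) || (y^-1 * x \in S) -> conn x y.
Proof.
move=> xy; have [<-|nxy] := eqVneq x y; first by exists [::].
by exists [:: y]; rewrite /= /cayley_adj nxy xy.
Qed.

Let conn_translate g x y : conn x y -> conn (g * x) (g * y).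
Proof.
move=> [p [px <-]]; exists (map ( *%g g) p); rewrite last_map; split=> //.
rewrite path_map; apply: sub_path px => a b /=.
by rewrite /cayley_adj /= (inj_eq (mulgI g)) !invgM -!mulgA !mulKg.
Qed.

Let conn_sym x y : conn x y -> conn y x.
Proof.
move=> [p [px <-]]; exists (rev (belast x p)); rewrite rev_path; split.
  by apply: sub_path px => a b; rewrite cayley_adj_sym.
by case: p {px} => //= a p; rewrite rev_cons last_rcons.
Qed.

Lemma cayley_connected x y :
  exists p, path cayley_adj x p /\ last x p = y.
Proof.
have H1 g : conn 1 g.
  suff : g \in [pred g | `[< conn 1 g >]] by move=> /asboolP.
  apply: genS; first split.
  - by apply/asboolP; exists [::].
  - move=> u v /asboolP cu /asboolP cv; apply/asboolP.
    apply: conn_trans cu _.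
    have := conn_translate (u / v) (conn_sym cv).
    rewrite mulg1 /= -mulgA mulVg mulg1 => h; exact: h.
  - move=> s sS; apply/asboolP; apply: conn1.
    by rewrite invg1 mul1g sS.
exact: conn_trans (conn_sym (H1 x)) (H1 y).
Qed.

Definition cayley_graph : graph :=
  Graph cayley_adj_sym cayley_adj_irr cayley_connected.

End Cayley.

Section Thompson.
Variable R : realType.
Implicit Types (f g : R -> R) (x y : R).

Definition dyadic (x : R) : Prop := exists (z : int) (k : nat), x = z%:~R / 2 ^+ k.

(* [f] is affine with slope a power of 2 on every subinterval of [0, 1] whose
   interior avoids some finite set of dyadic points. *)
Definition pl_dyadic f : Prop :=
  exists2 s : seq R, {in s, forall x, dyadic x} &
  forall a b : R, 0 <= a -> a <= b -> b <= 1 ->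
    {in s, forall c, ~~ (a < c < b)} ->
    exists (m : int) (k : R), forall x, a <= x <= b -> f x = 2 ^ m * x + k.

Definition homeomorphism f : Prop :=
  exists g, [/\ cancel f g, cancel g f, continuous f & continuous g].

(* A homeomorphism of [0, 1] preserving the orientation is identified with its
   extension to the real line by the identity. *)
Definition in_thompson f : Prop :=
  [/\ homeomorphism f, {homo f : x y / x < y},
      forall x, ~~ (0 <= x <= 1) -> f x = x & pl_dyadic f].

Record thompson : Type := Thompson {
  thompson_fun :> R -> R;
  thompsonP : in_thompson thompson_fun
}.

HB.instance Definition _ := gen_eqMixin thompson.
HB.instance Definition _ := gen_choiceMixin thompson.

Lemma thompson_ext (f g : thompson) : (forall x, f x = g x) -> f = g.
Proof.
case: f g => [f Pf] [g Pg] /= /funext fg; rewrite fg in Pf *.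
by rewrite (Prop_irrelevance Pf Pg).
Qed.

Lemma dyadic0 : dyadic 0.
Proof. by exists 0, 0%N; rewrite mul0r. Qed.

Lemma dyadicD x y : dyadic x -> dyadic y -> dyadic (x + y).
Proof.
move=> [a [k ->]] [b [l ->]].
exists (a * 2 ^+ l + b * 2 ^+ k), (k + l)%N.
rewrite exprD rmorphD !rmorphM !rmorphXn /= mulrDl.
have n2 j : (2 ^+ j : R) != 0 by rewrite expf_neq0 ?pnatr_eq0.
rewrite -mulf_div divff ?mulr1 //; congr (_ + _).
by rewrite [2 ^+ k * _]mulrC -mulf_div divff ?mulr1.
Qed.

Lemma dyadicN x : dyadic x -> dyadic (- x).
Proof. by move=> [a [k ->]]; exists (- a), k; rewrite rmorphN mulNr. Qed.

Lemma dyadic_scale (m : int) x : dyadic x -> dyadic (2 ^ m * x).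
Proof.
move=> [a [k ->]]; case: m => m.
  by exists (2 ^+ m * a), k; rewrite rmorphM rmorphXn mulrA.
exists a, (m.+1 + k)%N; rewrite -[2 ^ Negz m]/(2 ^- m.+1) exprD invfM.
by rewrite mulrCA.
Qed.

Lemma in_thompson_id : in_thompson id.
Proof.
split=> //.
  by exists id; split=> // x; exact: cvg_id.
exists [::] => // a b _ _ _ _; exists 0, 0 => x _.
by rewrite expr0z mul1r addr0.
Qed.

Lemma thompson_le f : in_thompson f -> {mono f : x y / x <= y}.
Proof. by case=> _ /le_mono. Qed.

Lemma thompson_lt f : in_thompson f -> {mono f : x y / x < y}.
Proof. by move=> /thompson_le /leW_mono. Qed.

Lemma thompson_itv f x : in_thompson f -> (0 <= f x <= 1) = (0 <= x <= 1).
Proof.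
move=> Tf; have [_ _ fid _] := Tf.
have inj : injective f by apply: inc_inj; exact: thompson_le.
have [xI|xI] := boolP (0 <= x <= 1); last by rewrite fid // (negbTE xI).
apply/negPn/negP => nfx; move: (fid _ nfx) => /inj fx.
by move: nfx; rewrite fx xI.
Qed.

Lemma thompson0 f : in_thompson f -> f 0 = 0.
Proof.
move=> Tf; have [[g [fg gf _ _]] _ _ _] := Tf.
have mono := thompson_le Tf.
have := thompson_itv 0 Tf; rewrite lexx ler01 => /andP[f0 _].
have := thompson_itv (g 0) Tf; rewrite gf lexx ler01 => /esym/andP[g0 _].
by apply/le_anti; rewrite f0 andbT -{2}(gf 0) mono.
Qed.

Lemma thompson1 f : in_thompson f -> f 1 = 1.
Proof.
move=> Tf; have [[g [fg gf _ _]] _ _ _] := Tf.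
have mono := thompson_le Tf.
have := thompson_itv 1 Tf; rewrite lexx ler01 => /andP[_ f0].
have := thompson_itv (g 1) Tf; rewrite gf lexx ler01 => /esym/andP[_ g0].
by apply/le_anti; rewrite f0 /= -{1}(gf 1) mono.
Qed.

Let count_ltn (T : eqType) (P Q : pred T) (s : seq T) c :
  subpred P Q -> c \in s -> Q c -> ~~ P c -> (count P s < count Q s)%N.
Proof.
move=> PQ cs Qc nPc; apply: (@leq_trans (count (predU P (pred1 c)) s)).
  rewrite -[ltnRHS]addn0.
  have <- : count (predI P (pred1 c)) s = 0%N.
    apply/eqP; rewrite -leqn0 leqNgt -has_count; apply/hasPn => d _ /=.
    by apply/negP => /andP[Pd /eqP dc]; rewrite dc (negbTE nPc) in Pd.
  by rewrite count_predUI -addn1 leq_add2l -has_count has_pred1.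
by apply: sub_count => d /= /orP[/PQ //|/eqP ->].
Qed.

Lemma thompson_dyadic f x :
  in_thompson f -> 0 <= x <= 1 -> dyadic x -> dyadic (f x).
Proof.
move=> Tf /andP[x0 x1] dx; have [_ _ _ [s sd saff]] := Tf.
suff main (N : nat) (a y : R) : (count (fun c => a < c < y)%R s < N)%N -> 0 <= a -> a <= y ->
    y <= 1 -> dyadic a -> dyadic y -> dyadic (f a) -> dyadic (f y).
  by apply: (main _ 0 x (ltnSn _)) => //; rewrite ?thompson0 //; exact: dyadic0.
elim: N a y => // N IH a y; rewrite ltnS => cN a0 ay y1 da dy dfa.
have [/hasP[c cs acy]|/hasPn sx] := boolP (has (fun c => a < c < y) s).
  have dc := sd _ cs; have /andP[ac cy] := acy.
  have dfc : dyadic (f c).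
    apply: (IH a) => //; [|exact: ltW|exact: le_trans (ltW cy) y1].
    apply: leq_trans cN; apply: (count_ltn _ cs acy); last by rewrite ltxx andbF.
    by move=> d /andP[-> /lt_trans]; apply.
  apply: (IH c) => //; [|exact: le_trans a0 (ltW ac)|exact: ltW].
  apply: leq_trans cN; apply: (count_ltn _ cs acy); last by rewrite ltxx.
  by move=> d /andP[cd ->]; rewrite (lt_trans ac cd).
have [m [k fE]] := saff _ _ a0 ay y1 sx.
have -> : f y = f a + 2 ^ m * (y + - a).
  by rewrite !fE ?lexx ?ay // mulrDr mulrN addrAC addrCA subrr addr0.
by apply: dyadicD => //; apply: dyadic_scale; apply: dyadicD => //;
  exact: dyadicN.
Qed.

Lemma in_thompson_inv f g :
  cancel f g -> cancel g f -> in_thompson f -> in_thompson g.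
Proof.
move=> fg gf Tf; have [[g' [fg' g'f cf cg]] _ fid [s sd saff]] := Tf.
have gg' : g' = g by apply/funext => x; rewrite -{1}(gf x) fg'.
rewrite {}gg' in cg.
have mono := thompson_le Tf; have smono := thompson_lt Tf.
split.
- by exists f; split.
- by move=> x y; rewrite -{1}(gf x) -{1}(gf y) smono.
- move=> x xI; rewrite -{1}(fid x xI) fg //.
exists [seq f c | c <- s & 0 <= c <= 1].
  move=> _ /mapP[c + ->]; rewrite mem_filter => /andP[cI cs].
  by apply: thompson_dyadic => //; exact: sd.
move=> a b a0 ab b1 sab.
have /andP[ga0 ga1] : 0 <= g a <= 1.
  by rewrite -(thompson_itv _ Tf) gf a0 (le_trans ab).
have /andP[gb0 gb1] : 0 <= g b <= 1.
  by rewrite -(thompson_itv _ Tf) gf b1 (le_trans a0).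
have gab : g a <= g b by rewrite -mono !gf.
have [c cs|m [k fE]] := saff _ _ ga0 gab gb1.
  apply/negP => /andP[ac cb].
  have : f c \in [seq f c | c <- s & 0 <= c <= 1].
    apply: map_f; rewrite mem_filter cs (le_trans ga0 (ltW ac)).
    by rewrite (le_trans (ltW cb) gb1).
  by move/sab; rewrite -(gf a) -(gf b) !smono ac cb.
exists (- m), (- (2 ^ (- m) * k)) => x /andP[ax xb].
have gx : g a <= g x <= g b by rewrite -(mono (g a)) -(mono (g x)) !gf ax.
have xE : x = 2 ^ m * g x + k by rewrite -fE ?gf.
rewrite {2}xE mulrDr addrK mulrA -expfzDr ?pnatr_eq0 //.
by rewrite addNr expr0z mul1r.
Qed.

Lemma in_thompson_comp f g :
  in_thompson f -> in_thompson g -> in_thompson (f \o g).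
Proof.
move=> Tf Tg; have [[f' [ff' f'f cf cf']] fh fid [s sd saff]] := Tf.
have [[g' [gg' g'g cg cg']] gh gid [t td taff]] := Tg.
have gm := thompson_le Tg; have gsm := thompson_lt Tg.
have Tg' := in_thompson_inv gg' g'g Tg.
split.
- exists (g' \o f'); split.
  + by move=> x /=; rewrite ff' gg'.
  + by move=> x /=; rewrite g'g f'f.
  + by move=> x; apply: continuous_comp; [exact: cg|exact: cf].
  + by move=> x; apply: continuous_comp; [exact: cf'|exact: cg'].
- by move=> x y xy /=; apply: fh; exact: gh.
- by move=> x xI /=; rewrite gid // fid.
exists (t ++ [seq g' c | c <- s & 0 <= c <= 1]).
  move=> x; rewrite mem_cat => /orP[/td //|/mapP[c + ->]].
  rewrite mem_filter => /andP[cI cs].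
  by apply: thompson_dyadic => //; exact: sd.
move=> a b a0 ab b1 stab.
have [c ct|m [k gE]] := taff _ _ a0 ab b1.
  by apply: stab; rewrite mem_cat ct.
have /andP[ga0 ga1] : 0 <= g a <= 1.
  by rewrite (thompson_itv _ Tg) a0 (le_trans ab).
have /andP[gb0 gb1] : 0 <= g b <= 1.
  by rewrite (thompson_itv _ Tg) b1 (le_trans a0).
have gab : g a <= g b by rewrite gm.
have [c cs|m' [k' fE]] := saff _ _ ga0 gab gb1.
  apply/negP => /andP[ac cb].
  have : g' c \in t ++ [seq g' c | c <- s & 0 <= c <= 1].
    rewrite mem_cat; apply/orP; right; apply: map_f; rewrite mem_filter cs.
    by rewrite (le_trans ga0 (ltW ac)) (le_trans (ltW cb) gb1).
  by move/stab; rewrite -(gsm a) -(gsm _ b) g'g ac cb.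
exists (m' + m), (2 ^ m' * k + k') => x axb.
have /andP[ax xb] := axb.
rewrite /= fE ?gm ?ax ?xb // gE //.
by rewrite mulrDr mulrA -expfzDr ?pnatr_eq0 // addrA.
Qed.

Definition thompson_one : thompson := Thompson in_thompson_id.

Definition thompson_mul (f g : thompson) : thompson :=
  Thompson (in_thompson_comp (thompsonP f) (thompsonP g)).

Lemma thompson_inv_ex (f : thompson) :
  exists g : thompson, cancel f g /\ cancel g f.
Proof.
have Tf := thompsonP f; have [[g [fg gf _ _]] _ _ _] := Tf.
by exists (Thompson (in_thompson_inv fg gf Tf)).
Qed.

Definition thompson_inv (f : thompson) : thompson :=
  projT1 (cid (thompson_inv_ex f)).

Let thompson_mulA : associative thompson_mul.
Proof. by move=> f g h; exact: thompson_ext. Qed.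

Let thompson_mul1 : left_id thompson_one thompson_mul.
Proof. by move=> f; exact: thompson_ext. Qed.

Let thompson_mulr1 : right_id thompson_one thompson_mul.
Proof. by move=> f; exact: thompson_ext. Qed.

Let thompson_mulV : left_inverse thompson_one thompson_inv thompson_mul.
Proof.
move=> f; apply: thompson_ext => x /=.
by rewrite /thompson_inv; case: cid => g /= [fg _]; rewrite fg.
Qed.

Let thompson_mulrV : right_inverse thompson_one thompson_inv thompson_mul.
Proof.
move=> f; apply: thompson_ext => x /=.
by rewrite /thompson_inv; case: cid => g /= [_ gf]; rewrite gf.
Qed.

HB.instance Definition _ := isGroup.Build thompson
  thompson_mulA thompson_mul1 thompson_mulr1 thompson_mulV thompson_mulrV.

End Thompson.

(* Main.v *)
Require Import Defs.
From HB Require Import structures.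
From mathcomp Require Import all_boot all_order all_algebra.
From mathcomp Require Import all_classical all_reals all_analysis.
From mathcomp Require Import zify lra.

(** Why the theorem holds. Sending an element of Thompson's group to the
    logarithms of its slopes at 0 and at 1 is a homomorphism onto Z^2. It splits:
    [half_shift_thompson] is supported on the left half of the interval and has
    slope 2 at 0, and it commutes with its mirror image at the right end. So
    Thompson's group retracts onto a copy of Z^2, and the two logarithms are
    Lipschitz functions on the Cayley graph. It suffices to let the robber walk in
    this copy of Z^2 and to watch the cops through these two coordinates
    ([cayley_no_strong_win]).

    In Z^2 a fast robber evades any number [n] of cops, whatever their reach. Take
    [n + 1] horizontal and [n + 1] vertical lines with a spacing [L] much larger
    than the reach. The robber is so fast that each cop covers less than a quarter of
    [L] during the time [T] that it takes to walk from one crossing to any other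
    crossing on the same line; a cop therefore endangers at most one line of each
    direction during a time [2 * T], and some line of each direction is left
    ([clear_line]). Walking along a line chosen in this way, the robber heads for
    the crossing with a line of the other direction that is clear for [2 * T] at
    the moment of the choice; it arrives there within [T], and the new line is
    still clear for another [T], which is what the next leg needs
    ([secure_renew], [secure_step]). The robber thus survives forever inside a
    fixed square, contained in a ball around the treasure whose radius does not
    depend on the strategy of the cops. *)

Set Implicit Arguments.
Unset Strict Implicit.
Unset Printing Implicit Defensive.
Import Order.TTheory GRing.Theory Num.Theory numFieldNormedType.Exports.

(** * Distances in graphs *)

(** Classical decidable equality on vertices gives access to the membership
    predicate [_ \in _] for lists of vertices. *)
HB.instance Definition _ (G : graph) := gen_eqMixin (vertex G).

Section Distance.
Variable G : graph.
Implicit Types (x y : G) (q : seq G) (f : G -> int).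

Lemma dist_path x y :
  exists q, [/\ path (@adj G) x q, last x q = y & size q = dist x y].
Proof. by rewrite /dist; case: ex_minnP => k /asboolP. Qed.

Lemma dist_le x q : path (@adj G) x q -> (dist x (last x q) <= size q)%N.
Proof.
by move=> xq; rewrite /dist; case: ex_minnP => k _; apply; apply/asboolP; exists q.
Qed.

Lemma dist_sym x y : dist x y = dist y x.
Proof.
suff le (u v : G) : (dist v u <= dist u v)%N by apply/eqP; rewrite eqn_leq !le.
have [q [uq <- <-]] := dist_path u v.
have vq : path (@adj G) (last u q) (rev (belast u q)).
  by rewrite rev_path; apply: sub_path uq => a b; rewrite adj_sym.
have := dist_le vq; rewrite size_rev size_belast.
by case: q {uq vq} => //= a q; rewrite rev_cons last_rcons.
Qed.

Definition edge_lipschitz C f :=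
  forall x y, adj x y -> (`|f x - f y|%N <= C)%N.

Lemma path_lipschitz C f x q : edge_lipschitz C f -> path (@adj G) x q ->
  {in x :: q, forall z, (`|f x - f z|%N <= C * size q)%N}.
Proof.
move=> Cf; elim: q x => [|y q IH] x /=.
  by move=> _ z; rewrite inE => /eqP->; lia.
move=> /andP[xy yq] z; rewrite inE => /predU1P[->|zq]; first lia.
by have := IH _ yq _ zq; have := Cf _ _ xy; rewrite mulnS; lia.
Qed.

Lemma dist_lipschitz C f x y : edge_lipschitz C f ->
  (`|f x - f y|%N <= C * dist x y)%N.
Proof.
move=> Cf; have [q [xq <- <-]] := dist_path x y.
by apply: path_lipschitz => //; exact: mem_last.
Qed.

End Distance.

(** * Play as a function of the robber's past moves *)
Section History.
Variables (G : graph) (n : nat) (S : cop_strategy G n) (r0 : G).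
Implicit Types (w : nat -> seq G) (h : seq (seq G)) (m : seq G).

(** Positions on the board after a finite list [h] of robber moves. The default
    value [[::]] of [nth] lets the robber stand still once [h] is exhausted. *)
Definition robber_at h := robber_pos r0 (nth [::] h) (size h).
Definition cop_at h := cop_pos S r0 (nth [::] h) (size h).

Lemma mkseq_nth_mkseq w t : mkseq (nth [::] (mkseq w t)) t = mkseq w t.
Proof. by rewrite -{2}(size_mkseq w t) mkseq_nth. Qed.

Lemma mkseqS_inj w w' t : mkseq w t.+1 = mkseq w' t.+1 ->
  mkseq w t = mkseq w' t /\ w t = w' t.
Proof. by rewrite !mkseqS => /rcons_inj[]. Qed.

Lemma robber_pos_mkseq w w' t :
  mkseq w t = mkseq w' t -> robber_pos r0 w t = robber_pos r0 w' t.
Proof. by elim: t => //= t IH /mkseqS_inj[/IH-> ->]. Qed.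

Lemma cop_pos_mkseq w w' t i :
  mkseq w t = mkseq w' t -> cop_pos S r0 w t i = cop_pos S r0 w' t i.
Proof.
by elim: t => //= t IH /mkseqS_inj[ww' _]; rewrite IH // /cop_walk ww'.
Qed.

Lemma robber_at_mkseq w t : robber_at (mkseq w t) = robber_pos r0 w t.
Proof.
by rewrite /robber_at size_mkseq; apply: robber_pos_mkseq; exact: mkseq_nth_mkseq.
Qed.

Lemma cop_at_mkseq w t i : cop_at (mkseq w t) i = cop_pos S r0 w t i.
Proof.
by rewrite /cop_at size_mkseq; apply: cop_pos_mkseq; exact: mkseq_nth_mkseq.
Qed.

Lemma rcons_mkseq h m : exists w t, h = mkseq w t /\ m = w t.
Proof.
exists (nth [::] (rcons h m)), (size h).
have : rcons h m = mkseq (nth [::] (rcons h m)) (size h).+1.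
  by rewrite -(size_rcons h m) mkseq_nth.
by rewrite mkseqS => /rcons_inj[].
Qed.

Lemma robber_at_rcons h m : robber_at (rcons h m) = last (robber_at h) m.
Proof. by have [w [t [-> ->]]] := rcons_mkseq h m; rewrite -mkseqS !robber_at_mkseq. Qed.

Lemma cop_at_rcons h m i :
  cop_at (rcons h m) i = last (cop_at h i) (cop_move S r0 h i).
Proof. by have [w [t [-> ->]]] := rcons_mkseq h m; rewrite -mkseqS !cop_at_mkseq. Qed.

End History.

(** Turns a robber who decides each move [m] in view of the past [h] into the
    fixed infinite list of moves that the winning condition quantifies over:
    dependent choice, where [P] is the invariant and [Q] what is wanted of each
    single move. *)
Lemma adaptive_play (T : Type) (P : seq T -> Prop) (Q : seq T -> T -> Prop) :
  P [::] -> (forall h, P h -> exists m, Q h m /\ P (rcons h m)) ->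
  exists w : nat -> T, forall t, P (mkseq w t) /\ Q (mkseq w t) (w t).
Proof.
move=> P0 step.
have [m0 _] := step _ P0.
have /choice[next nextP] : forall h, exists m, P h -> Q h m /\ P (rcons h m).
  by move=> h; have [/step[m ?]|?] := pselect (P h); [exists m|exists m0].
pose hist := fix hist t := if t is t'.+1 then rcons (hist t') (next (hist t')) else [::].
have histE t : hist t = mkseq (next \o hist) t.
  by elim: t => //= t IH; rewrite mkseqS -IH.
exists (next \o hist) => t; rewrite -histE /=.
have Pt : P (hist t) by elim: t => //= t /nextP[].
by split=> //; case: (nextP _ Pt).
Qed.

(** * Evasion on a grid of lines *)
Section Grid.
Variables (G : graph) (C : nat).
(* [f] gives the two coordinates of a vertex and [p] embeds the quarter plane.
   The Boolean [b] singles out one of the two directions: [p b x y] is the point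
   with coordinate [x] in the direction [b] and [y] in the other one. *)
Variables (f : bool -> G -> int) (p : bool -> nat -> nat -> G).
Hypothesis f_lip : forall b, edge_lipschitz C (f b).
Hypothesis fp : forall b x y, f b (p b x y) = x.
Hypothesis p_swap : forall b x y, p (~~ b) y x = p b x y.
Hypothesis p_step : forall b x y, (dist (p b x y) (p b x.+1 y) <= C)%N.

Lemma fp_swap b x y : f (~~ b) (p b x y) = y.
Proof. by rewrite -p_swap fp. Qed.

(** Walking in the direction [b] between two points on a line of the grid: the
    walk leaves the grid between consecutive points, but each such excursion has
    length at most [C], hence changes the other coordinate by at most
    [C * C]. *)
Lemma grid_route b x x' y : exists q,
  [/\ path (@adj G) (p b x y) q, last (p b x y) q = p b x' y,
      (size q <= C * `|x - x'|)%N &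
      {in p b x y :: q, forall z, (`|f (~~ b) z - y| <= C * C)%N}].
Proof.
have [d] := ubnP `|x - x'|%N; elim: d x => // d IH x xx'.
have [<-|nxx'] := eqVneq x x'.
  exists [::]; split=> // z; rewrite inE => /eqP->; rewrite fp_swap; lia.
pose x1 := if (x < x')%N then x.+1 else x.-1.
have x1x' : (`|x - x'| = `|x1 - x'|.+1)%N by rewrite /x1; case: ifP; lia.
have [|q [q1 q2 q3 q4]] := IH x1; first lia.
have : (dist (p b x y) (p b x1 y) <= C)%N.
  rewrite /x1; case: ifP => [//|xlt].
  have -> : x = x.-1.+1 by lia.
  by rewrite dist_sym.
have [s [s1 s2 <-]] := dist_path (p b x y) (p b x1 y) => sC.
exists (s ++ q); split.
- by rewrite cat_path s1 s2.
- by rewrite last_cat s2.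
- by rewrite size_cat x1x' mulnS leq_add.
move=> z; rewrite -cat_cons mem_cat => /orP[zs|zq].
  have := path_lipschitz (f_lip (~~ b)) s1 zs; rewrite fp_swap.
  (* The first grid step is an excursion off the line, of length at most [C]. *)
  have : (C * size s <= C * C)%N by rewrite leq_mul2l sC orbT.
  lia.
by apply: q4; rewrite inE zq orbT.
Qed.

Section Evasion.
Variables (n sigma rho T L : nat).
(** The line number [k] is the set of points whose coordinate in the direction
    [b] is [k * L]; hence it runs in the direction [~~ b]. The margin is such that
    no cop can threaten a robber using this line during the next [s] stages: a
    cop gets nearer by at most [C * sigma] per stage, [C * C] accounts for the
    excursions of the robber off the line, and [C * rho] for the reach. *)
Definition line_clear b k s (c : 'I_n -> G) := forall i,
  (C * rho + C * C + C * sigma * s < `|f b (c i) - (k * L)|)%N.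

Variables (K R : nat) (v : G) (S : cop_strategy G n).
Hypothesis winS : winning v sigma (C * K) rho R S.
Variable r0 : G.
Implicit Types (h : seq (seq G)) (m : seq G).

Definition legal_history h := forall t, (t < size h)%N ->
  legal_move (C * K) (robber_pos r0 (nth [::] h) t) (nth [::] h t).

Lemma legal_history_rcons h m : legal_history h ->
  legal_move (C * K) (robber_at r0 h) m -> legal_history (rcons h m).
Proof.
move=> hh hm t; rewrite size_rcons ltnS => th.
have -> : robber_pos r0 (nth [::] (rcons h m)) t = robber_pos r0 (nth [::] h) t.
  apply: robber_pos_mkseq.
  by rewrite /mkseq !map_nth_iota0 ?size_rcons ?leqW // -cats1 takel_cat.
rewrite nth_rcons; case: ltnP => [|ht]; first exact: hh.
have -> : t = size h by apply/eqP; rewrite eqn_leq th ht.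
by rewrite eqxx.
Qed.

(** A winning strategy answers only infinite legal plays by legal moves; a
    finite play is turned into an infinite one by letting the robber stand
    still. *)
Lemma cop_legal h i : legal_history h ->
  legal_move sigma (cop_at S r0 h i) (cop_move S r0 h i).
Proof.
move=> hh; have [t|+ _] := winS (r0 := r0) (w := nth [::] h).
  have [/hh//|ht] := ltnP t (size h).
  by rewrite nth_default.
by move=> /(_ (size h) i); rewrite /cop_walk mkseq_nth.
Qed.

(** The invariant of the robber's strategy. The robber is on the line [k], running
    in the direction [b], on its way to the crossing with the line [k'], which it
    reaches within [tau] stages; the line [k] stays clear that long, and [k'] stays
    clear for [T] more stages, enough to walk along it to any other crossing. *)
Definition secure h tau := exists b x k k',
  [/\ robber_at r0 h = p b x (k * L), [/\ (x <= n * L)%N, (k <= n)%N & (k' <= n)%N],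
      (`|x - (k' * L)| <= K * tau)%N,
      line_clear (~~ b) k tau (cop_at S r0 h) & line_clear b k' (tau + T) (cop_at S r0 h)].

Definition uncaught h m := forall i,
  all (fun c => rho < dist c (robber_at r0 h))%N
    (cop_at S r0 h i :: cop_move S r0 h i) /\
  all (fun r => rho < dist (last (cop_at S r0 h i) (cop_move S r0 h i)) r)%N
    (robber_at r0 h :: m).

(** Being [C]-Lipschitz, one coordinate suffices to keep cop and robber apart. *)
Lemma far_uncaught b c r (a : int) s : (`|f b r - a| <= C * C)%N ->
  (C * rho + C * C + s < `|f b c - a|)%N -> (rho < dist c r)%N.
Proof.
move=> ra ca; have := dist_lipschitz c r (f_lip b) => cr.
have : (C * rho < C * dist c r)%N by lia.
by rewrite ltn_mul2l => /andP[].
Qed.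

(** In one stage the cops eat up one stage of the margins while the robber gets
    [K] grid steps nearer to its target; only the coordinate transverse to its
    line matters for its safety. *)
Lemma secure_step h tau : legal_history h -> secure h tau.+1 ->
  exists m, [/\ legal_move (C * K) (robber_at r0 h) m, uncaught h m &
                secure (rcons h m) tau].
Proof.
move=> hh [b [x [k [k' [rE [xn kn k'n] xk' c c']]]]].
have copmove b' i z : z \in cop_at S r0 h i :: cop_move S r0 h i ->
    (`|f b' (cop_at S r0 h i) - f b' z| <= C * sigma)%N.
  have [ci si] := cop_legal i hh => zi.
  apply: leq_trans (path_lipschitz (f_lip b') ci zi) _.
  by rewrite leq_mul2l si orbT.
have clear_step b' j s : line_clear b' j s.+1 (cop_at S r0 h) -> forall i z,
    z \in cop_at S r0 h i :: cop_move S r0 h i ->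
    (C * rho + C * C + C * sigma * s < `|f b' z - (j * L)|)%N.
  by move=> cj i z /(copmove b'); have := cj i; rewrite mulnS; lia.
(* The robber advances by [K] grid steps, or less if this reaches the target. *)
pose x' := if (x <= k' * L)%N then minn (x + K) (k' * L) else maxn (x - K) (k' * L).
have k'L : (k' * L <= n * L)%N by rewrite leq_mul2r k'n orbT.
have x'n : (x' <= n * L)%N by rewrite /x'; case: ifP; lia.
have xx' : (`|x - x'| <= K)%N by rewrite /x'; case: ifP; lia.
have x'k' : (`|x' - (k' * L)| <= K * tau)%N.
  by move: xk'; rewrite mulnS /x'; case: ifP; lia.
have [m [m1 m2 m3 m4]] := grid_route b x x' (k * L).
have lm : legal_move (C * K) (robber_at r0 h) m.
  rewrite rE; split=> //; apply: leq_trans m3 _.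
  by rewrite leq_mul2l xx' orbT.
exists m; split=> //.
  move=> i; split; apply/allP => z zi.
    apply: (far_uncaught (b := ~~ b)) (clear_step _ _ _ c i z zi).
    by rewrite rE fp_swap; lia.
  apply: (far_uncaught (b := ~~ b)) (clear_step _ _ _ c i _ (mem_last _ _)).
  by move: zi; rewrite rE => /m4.
exists b, x', k, k'; split=> //.
- by rewrite robber_at_rcons rE.
- by move=> i; rewrite cop_at_rcons; apply: clear_step c _ _ (mem_last _ _).
- by move=> i; rewrite cop_at_rcons; apply: clear_step c' _ _ (mem_last _ _).
Qed.

Hypothesis L_large : (2 * (C * rho + C * C + C * sigma * (T + T)) < L)%N.

(** There are [n + 1] parallel lines, and two lines blocked by the same cop would
    be at distance less than [L]; so [n] cops cannot block all of them. *)
Lemma clear_line b (c : 'I_n -> G) : exists2 k, (k <= n)%N & line_clear b k (T + T) c.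
Proof.
apply: contrapT => none.
have blocked (k : 'I_n.+1) : exists i,
    (`|f b (c i) - (k * L)| <= C * rho + C * C + C * sigma * (T + T))%N.
  apply: contrapT => nb; apply: none; exists k; first by rewrite -ltnS.
  by move=> i; rewrite ltnNge; apply/negP => le; apply: nb; exists i.
have [g gP] := choice blocked.
have /injectivePn[k [k' kk' gkk']] : ~~ injectiveb g.
  by apply/negP => /injectiveP/leq_card; rewrite !card_ord ltnn.
have := gP k'; rewrite -gkk'; have := gP k.
have : (L <= `|(k * L) - (k' * L)|)%N.
  have : (k < k')%N \/ (k' < k)%N.
    by case: (ltngtP k k') => [||/val_inj e]; [left|right|rewrite e eqxx in kk'].
  case; rewrite -(leq_pmul2r (leq_ltn_trans (leq0n _) L_large)) mulSn; lia.
lia.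
Qed.

Hypothesis KT : (n * L <= K * T)%N.

(** On arrival at the crossing the roles rotate: the target line becomes the
    current line, and a line clear at this very moment becomes the target. *)
Lemma secure_renew h : secure h 0 -> secure h T.
Proof.
move=> [b [x [k [k' [rE [xn kn k'n] xk' _ c']]]]].
have [k'' k''n c''] := clear_line (~~ b) (cop_at S r0 h).
exists (~~ b), (k * L)%N, k', k''; split=> //.
- by rewrite rE -p_swap; congr (p _ _ _); move: xk'; rewrite muln0; lia.
- by rewrite leq_mul2r kn orbT.
- apply: leq_trans KT.
  have lek : (k * L <= n * L)%N by rewrite leq_mul2r kn orbT.
  have lek'' : (k'' * L <= n * L)%N by rewrite leq_mul2r k''n orbT.
  lia.
- by rewrite negbK.
Qed.

End Evasion.

(** The robber starts at a crossing of two clear lines. The positions that it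
    takes later lie in a square known before the cops choose their strategy, whence the
    bound [R] for the distance to the treasure [v]. *)
Lemma grid_evasion n sigma rho K T L R v (S : cop_strategy G n) :
  (0 < T)%N -> (n * L <= K * T)%N ->
  (2 * (C * rho + C * C + C * sigma * (T + T)) < L)%N ->
  (forall b x y, (x <= n * L)%N -> (y <= n * L)%N -> (dist v (p b x y) <= R)%N) ->
  ~ winning v sigma (C * K) rho R S.
Proof.
move=> T_gt0 KT L_large R_large winS.
have [k kn ck] := clear_line L_large true (cop_start S).
have [k' k'n ck'] := clear_line L_large false (cop_start S).
pose r0 := p true (k * L) (k' * L).
pose P h := legal_history K r0 h /\ exists tau, secure sigma rho T L K S r0 h tau.
pose Q h m := [/\ legal_move (C * K) (robber_at r0 h) m,
  uncaught rho S r0 h m & (dist v (robber_at r0 h) <= R)%N].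
have [|h [lh [tau sh]]|w wP] := @adaptive_play _ P Q.
- split=> //; exists 0%N, true, (k * L)%N, k', k.
  split=> //.
  + by rewrite leq_mul2r kn orbT.
  + by rewrite muln0; lia.
  + by move=> i; have := ck' i; rewrite /cop_at /=; lia.
  + by move=> i; have := ck i; rewrite /cop_at /=; lia.
- have [tau' sh'] : exists tau', secure sigma rho T L K S r0 h tau'.+1.
    case: tau sh => [|tau] sh; last by exists tau.
    exists T.-1; rewrite prednK //; exact: secure_renew.
  have [m [lm um sm]] := secure_step winS lh sh'.
  exists m; split; last by split; [exact: legal_history_rcons|exists tau'].
  split=> //; have [b [x [j [j' [-> [xn jn _] _ _ _]]]]] := sh.
  by apply: R_large => //; rewrite leq_mul2r jn orbT.
have wQ t := proj2 (wP t).
have [t|_ [[t [i]]|[t /(_ t (leqnn t))]]] := winS r0 w.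
- by have [+ _ _] := wQ t; rewrite robber_at_mkseq.
- have [_ /(_ i)[/allP cc /allP rr] _] := wQ t.
  rewrite robber_at_mkseq !cop_at_mkseq in cc rr.
  by case=> /hasP[z]; [move/cc|move/rr]; rewrite ltnNge => /negP.
have [_ _] := wQ t; rewrite robber_at_mkseq => le /andP[].
by rewrite ltnNge le.
Qed.

(** The order of the quantifiers matters: the robber must be fast compared with
    [n] and [sigma], before the reach [rho] is known, whereas the spacing [L] of
    the lines may depend on [rho]. With [K] proportional to [n], the ratio of [L]
    to the time [T] needed to cross the square does not involve [rho]; both are
    then scaled up until the reach is negligible. *)
Lemma grid_no_strong_win n : (0 < C)%N -> (0 < n)%N -> ~ strong_cop_win G n.
Proof.
move=> C_gt0 n_gt0 /(_ (p true 0 0)) [sigma _].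
(* Crossing the square takes [T] stages as soon as [n * L = K * T], and in [2 * T]
   stages the cops must not cover [L / 2]: thus [L / T] must exceed
   [4 * C * sigma]. *)
pose K := (n * (4 * (C * sigma)).+1)%N.
case/(_ (C * K)%N); first by rewrite !muln_gt0 C_gt0 n_gt0.
move=> rho _.
pose T := (2 * (C * rho + C * C)).+1.
pose L := ((4 * (C * sigma)).+1 * T)%N.
pose R := (\max_(x < (n * L).+1) \max_(y < (n * L).+1)
  maxn (dist (p true 0 0) (p true x y)) (dist (p true 0 0) (p false x y)))%N.
case/(_ R.+1 (ltn0Sn R)) => S; apply: (grid_evasion (T := T) (L := L)) => //.
- by rewrite /K /L mulnA.
- by rewrite /L /T; lia.
move=> b x y; rewrite -!(ltnS _ (n * L)) => xn yn; apply: leqW.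
apply: leq_trans (leq_bigmax (Ordinal xn)).
apply: leq_trans (leq_bigmax (Ordinal yn)).
by rewrite leq_max; case: b; rewrite leqnn ?orbT.
Qed.

End Grid.

(** * Groups with a free abelian retract of rank two *)
Section CayleyGraph.
Variables (gT : groupType) (S : seq gT) (genS : generates S).
Local Open Scope group_scope.

Lemma cayley_dist_mulg (g x y : gT) :
  (dist (G := cayley_graph genS) (g * x)%g (g * y)%g <= dist (G := cayley_graph genS) x y)%N.
Proof.
have [q [xq <- <-]] := dist_path (G := cayley_graph genS) x y.
rewrite -(size_map ( *%g g)) -last_map.
apply: dist_le; rewrite path_map; apply: sub_path xq => u v /=.
by rewrite /cayley_adj /= (inj_eq (mulgI g)) !invgM -!mulgA !mulKg.
Qed.

Lemma cayley_morphism_lipschitz C (phi : gT -> int) :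
  (forall x y, phi (x * y)%g = phi x + phi y)%R ->
  {in S, forall s, (`|phi s| <= C)%N} ->
  edge_lipschitz (G := cayley_graph genS) C phi.
Proof.
move=> phiM phiC.
have key (u v : gT) : u^-1 * v \in S -> (`|(phi u - phi v)%R| <= C)%N.
  by move=> /phiC; have := phiM u (u^-1 * v); rewrite mulVKg; lia.
by move=> u v /andP[_ /orP[]] => /key //; lia.
Qed.

(** The hypotheses say that the pair [phi] retracts the group onto the free
    abelian subgroup generated by [g true] and [g false]. Homomorphisms are
    Lipschitz on Cayley graphs, so the cops may be watched through [phi] while the
    robber walks in the subgroup. *)
Lemma cayley_no_strong_win (phi : bool -> gT -> int) (g : bool -> gT) n :
  (forall b x y, phi b (x * y)%g = phi b x + phi b y)%R ->
  (forall b, phi b (g b) = 1%R) -> (forall b, phi b (g (~~ b)) = 0%R) ->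
  commute (g true) (g false) -> (0 < n)%N ->
  ~ strong_cop_win (cayley_graph genS) n.
Proof.
move=> phiM phi1 phi0 gC.
have phiX b x k : phi b (x ^+ k) = (phi b x * k)%R.
  elim: k => [|k IH]; last by rewrite expgS phiM IH; lia.
  by have := phiM b 1 1; rewrite mulg1 expg0; lia.
pose p b x y : cayley_graph genS := g b ^+ x * g (~~ b) ^+ y.
have gbC b : commute (g b) (g (~~ b)) by case: b.
(* One constant bounds both [phi] on the generators and the word length of [g b]. *)
pose d : gT -> nat := dist (G := cayley_graph genS) 1.
pose C := (\max_(s <- S) maxn `|phi true s| `|phi false s|
  + maxn (d (g true)) (d (g false)) + 1)%N.
move=> n_gt0; apply: (@grid_no_strong_win (cayley_graph genS) C phi p).
- move=> b; apply: cayley_morphism_lipschitz => // s sS.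
  rewrite /C -addnA; apply/ltnW; rewrite addn1 addnS ltnS.
  apply/leq_trans/leq_addr.
  have := leq_bigmax_seq s (F := fun s => maxn `|phi true s| `|phi false s|)%N sS isT.
  apply: leq_trans.
  by case: b; lia.
- by move=> b x y; rewrite phiM !phiX phi1 phi0; lia.
- by move=> b x y; rewrite /p negbK; exact/esym/commuteX2.
- move=> b x y.
  have -> : p b x.+1 y = (p b x y : gT) * g b :> gT.
    rewrite /p expgSr -!mulgA; congr (_ * _); exact: commuteX.
  rewrite -[X in dist X _](mulg1 (p b x y : gT)).
  apply: leq_trans (cayley_dist_mulg _ _ _) _.
  change (d (g b) <= C)%N; by rewrite /C; case: b; lia.
- by rewrite /C; lia.
- exact: n_gt0.
Qed.

End CayleyGraph.

(** * The logarithm of the slope at 0 *)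
Section Germ.
Local Open Scope ring_scope.
Variable R : realType.
Implicit Types f g : thompson R.

Definition germ0 (f : R -> R) (m : int) :=
  exists2 e : R, 0 < e & forall x, 0 <= x <= e -> f x = 2 ^ m * x.

(** Between 0 and the first positive breakpoint the map is affine, and it
    fixes 0. *)
Lemma germ0_ex f : exists m, germ0 f m.
Proof.
have Tf := thompsonP f; have [_ _ _ [s _ saff]] := Tf.
have [e /andP[e0 e1] es] : exists2 e : R, 0 < e <= 1 & {in s, forall c, ~~ (0 < c < e)}.
  elim: {saff} s => [|c s [e /andP[e0 e1] es]]; first by exists 1 => //; lra.
  exists (if 0 < c then Num.min c e else e).
    by case: ifP => c0; rewrite ?lt_min ?ge_min ?c0 e0 e1 ?orbT.
  move=> d; rewrite inE => /predU1P[->|/es de].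
    by case: ifP => c0; rewrite ?lt_min ?ltxx ?andbF // c0.
  by case: ifP => // c0; apply: contra de => /andP[->]; rewrite lt_min => /andP[_].
have [m [k fE]] := saff _ _ (lexx 0) (ltW e0) e1 es.
have k0 : k = 0.
  have := fE 0; rewrite thompson0 // mulr0 add0r lexx (ltW e0) => /(_ isT) //.
by exists m, e => // x /fE->; rewrite k0 addr0.
Qed.

Lemma germ0_uniq (f : R -> R) m m' : germ0 f m -> germ0 f m' -> m = m'.
Proof.
move=> [e e0 fm] [e' e'0 fm'].
pose d := Num.min e e'.
have d0 : 0 < d by rewrite lt_min e0.
have dd : (0 <= d <= e) && (0 <= d <= e').
  by rewrite ltW //= !ge_min !lexx orbT.
have /andP[/fm fd /fm' fd'] := dd.
have two : (2 : R) != 1 by rewrite gt_eqF // ltr1n.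
apply: (ieexprIz (ltr0Sn R 1) two).
by apply: (mulIf (lt0r_neq0 d0)); rewrite -fd.
Qed.

Lemma germ0_comp (f g : R -> R) m m' :
  germ0 f m -> germ0 g m' -> germ0 (f \o g) (m + m').
Proof.
move=> [e e0 fm] [e' e'0 gm].
have p2 : 0 < (2 : R) ^ m' by rewrite exprz_gt0.
exists (Num.min e' (e / 2 ^ m')); first by rewrite lt_min e'0 divr_gt0.
move=> x; rewrite le_min => /and3P[x0 xe' xe]; rewrite /= gm ?x0 // fm.
  by rewrite mulrA -expfzDr // pnatr_eq0.
by apply/andP; split; [rewrite mulr_ge0 // ltW|rewrite mulrC -ler_pdivlMr].
Qed.

Definition log_slope0 f : int := projT1 (cid (germ0_ex f)).

Lemma log_slope0P f m : germ0 f m -> log_slope0 f = m.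
Proof. by rewrite /log_slope0; case: cid => m' /= /germ0_uniq; exact. Qed.

Lemma log_slope0M f g : log_slope0 (f * g)%g = log_slope0 f + log_slope0 g.
Proof.
apply: log_slope0P; apply: (@germ0_comp f g);
  by rewrite /log_slope0; case: cid.
Qed.

End Germ.

(** * Conjugation by the reflection of the unit interval *)

(** Conjugation by [x |-> 1 - x] is an automorphism of Thompson's group that
    exchanges the two ends of the interval; it yields the slope at 1 from the
    slope at 0. *)
Section Reflection.
Local Open Scope ring_scope.
Variable R : realType.
Implicit Types f g : thompson R.

Lemma continuous_reflect (f : R -> R) :
  continuous f -> continuous (fun x : R => 1 - f (1 - x)).
Proof.
move=> cf x.
have c1 : {for x, continuous (fun y : R => 1 - y)}.
  by apply: cvgB; [exact: cvg_cst|exact: cvg_id].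
apply: cvgB; first exact: cvg_cst.
exact: (continuous_comp c1 (cf _)).
Qed.

Lemma in_thompson_reflect (f : R -> R) :
  in_thompson f -> in_thompson (fun x => 1 - f (1 - x)).
Proof.
move=> Tf; have [[g [fg gf cf cg]] fh fid [s sd saff]] := Tf.
split.
- exists (fun x => 1 - g (1 - x)); split; try exact: continuous_reflect.
  + by move=> x; rewrite !subKr fg subKr.
  + by move=> x; rewrite !subKr gf subKr.
- by move=> x y xy; rewrite ltrD2l ltrN2; apply: fh; lra.
- by move=> x xI; rewrite fid ?subKr //; apply: contra xI => /andP[? ?]; lra.
exists [seq 1 - c | c <- s].
  move=> _ /mapP[c /sd dc ->]; apply: dyadicD; last exact: dyadicN.
  by exists 1, 0%N; rewrite expr0 divr1.
move=> a b a0 ab b1 sab.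
have [|||c cs|m [k fE]] := saff (1 - b) (1 - a); try lra.
  by have := sab _ (map_f (fun c => 1 - c) cs); apply: contra => /andP[? ?]; lra.
exists m, (1 - k - 2 ^ m) => x /andP[ax xb]; rewrite fE; last lra.
by rewrite mulrBr mulr1; lra.
Qed.

Definition reflect_thompson f := Thompson (in_thompson_reflect (thompsonP f)).

Lemma reflect_thompsonM f g :
  reflect_thompson (f * g)%g = (reflect_thompson f * reflect_thompson g)%g.
Proof. by apply: thompson_ext => x /=; rewrite subKr. Qed.

Lemma reflect_thompsonK : involutive reflect_thompson.
Proof. by move=> f; apply: thompson_ext => x /=; rewrite !subKr. Qed.

End Reflection.

(** * An element supported on the left half of the interval *)
Section Generator.
Local Open Scope ring_scope.
Variable R : realType.

(** The standard generator of Thompson's group, squeezed into [0, 1/2]: slopes 2,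
    1, 1/2 with breakpoints 1/8, 1/4, 1/2. The lattice formula makes continuity
    immediate; the next lemmas recover the pieces. *)
Definition half_shift (x : R) : R :=
  Num.max x (Num.min (2 * x) (Num.min (x + 1 / 8) (x / 2 + 1 / 4))).
Definition half_unshift (x : R) : R :=
  Num.min x (Num.max (x / 2) (Num.max (x - 1 / 8) (2 * x - 1 / 2))).

Lemma half_shiftP x :
  [\/ x <= 0 /\ half_shift x = x, 0 <= x <= 1 / 8 /\ half_shift x = 2 * x,
      1 / 8 <= x <= 1 / 4 /\ half_shift x = x + 1 / 8 |
      1 / 4 <= x <= 1 / 2 /\ half_shift x = x / 2 + 1 / 4] \/
  1 / 2 <= x /\ half_shift x = x.
Proof.
have [h|h] := leP (1 / 2) x; [right|left; have [h1|h1] := leP x 0;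
  [constructor 1|have [h2|h2] := leP x (1 / 8);
  [constructor 2|have [h3|h3] := leP x (1 / 4);
  [constructor 3|constructor 4]]]];
  (split; first lra); rewrite /half_shift; case: (leP (x + 1 / 8) _) => ?;
  case: (leP (2 * x) _) => ?; case: (leP x _) => ?; lra.
Qed.

Lemma half_unshiftP x :
  [\/ x <= 0 /\ half_unshift x = x, 0 <= x <= 1 / 4 /\ half_unshift x = x / 2,
      1 / 4 <= x <= 3 / 8 /\ half_unshift x = x - 1 / 8 |
      3 / 8 <= x <= 1 / 2 /\ half_unshift x = 2 * x - 1 / 2] \/
  1 / 2 <= x /\ half_unshift x = x.
Proof.
have [h|h] := leP (1 / 2) x; [right|left; have [h1|h1] := leP x 0;
  [constructor 1|have [h2|h2] := leP x (1 / 4);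
  [constructor 2|have [h3|h3] := leP x (3 / 8);
  [constructor 3|constructor 4]]]];
  (split; first lra); rewrite /half_unshift; case: (leP (x - 1 / 8) _) => ?;
  case: (leP (x / 2) _) => ?; case: (leP x _) => ?; lra.
Qed.

Lemma half_shiftK : cancel half_shift half_unshift.
Proof.
move=> x; have := half_unshiftP (half_shift x).
by have [[]|] := half_shiftP x => -[h ->] [[]|] [h' ->]; lra.
Qed.

Lemma half_unshiftK : cancel half_unshift half_shift.
Proof.
move=> x; have := half_shiftP (half_unshift x).
by have [[]|] := half_unshiftP x => -[h ->] [[]|] [h' ->]; lra.
Qed.

Lemma continuous_half_shift : continuous half_shift.
Proof.
move=> x; apply: (@continuous_max _ _ (fun y : R => y)); first exact: cvg_id.
apply: (@continuous_min _ _ (fun y : R => 2 * y)).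
  by apply: cvgM; [exact: cvg_cst|exact: cvg_id].
apply: (@continuous_min _ _ (fun y : R => y + 1 / 8) (fun y => y / 2 + 1 / 4)).
  by apply: cvgD; [exact: cvg_id|exact: cvg_cst].
apply: cvgD; last exact: cvg_cst.
by apply: cvgM; [exact: cvg_id|exact: cvg_cst].
Qed.

Lemma continuous_half_unshift : continuous half_unshift.
Proof.
move=> x; apply: (@continuous_min _ _ (fun y : R => y)); first exact: cvg_id.
apply: (@continuous_max _ _ (fun y : R => y / 2)).
  by apply: cvgM; [exact: cvg_id|exact: cvg_cst].
apply: (@continuous_max _ _ (fun y : R => y - 1 / 8) (fun y => 2 * y - 1 / 2)).
  by apply: cvgB; [exact: cvg_id|exact: cvg_cst].
apply: cvgB; last exact: cvg_cst.
by apply: cvgM; [exact: cvg_cst|exact: cvg_id].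
Qed.

Lemma in_thompson_half_shift : in_thompson half_shift.
Proof.
split.
- by exists half_unshift; split; [exact: half_shiftK|exact: half_unshiftK|
    exact: continuous_half_shift|exact: continuous_half_unshift].
- move=> x y xy; have [[]|] := half_shiftP x => -[h ->];
    have [[]|] := half_shiftP y => -[h' ->]; lra.
- by move=> x xI; have [[]|] := half_shiftP x => -[h ->] //; lra.
exists [:: 1 / 8; 1 / 4; 1 / 2].
  move=> x; rewrite !inE => /or3P[]/eqP->.
  + by exists 1, 3%N; lra.
  + by exists 1, 2%N; lra.
  + by exists 1, 1%N; lra.
move=> a b a0 ab b1 sab.
have s1 : ~~ (a < 1 / 8 < b) by apply: sab; rewrite !inE eqxx.
have s2 : ~~ (a < 1 / 4 < b) by apply: sab; rewrite !inE eqxx orbT.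
have s3 : ~~ (a < 1 / 2 < b) by apply: sab; rewrite !inE eqxx !orbT.
have [b8|b8] := leP b (1 / 8).
  exists 1, 0 => x xab; rewrite expr1z.
  by have [[]|] := half_shiftP x => -[h ->]; lra.
have [b4|b4] := leP b (1 / 4).
  exists 0, (1 / 8) => x xab; rewrite expr0z.
  by have [[]|] := half_shiftP x => -[h ->]; lra.
have [b2|b2] := leP b (1 / 2).
  exists (-1), (1 / 4) => x xab; rewrite exprN1.
  by have [[]|] := half_shiftP x => -[h ->]; lra.
exists 0, 0 => x xab; rewrite expr0z.
by have [[]|] := half_shiftP x => -[h ->]; lra.
Qed.

Definition half_shift_thompson : thompson R := Thompson in_thompson_half_shift.

Lemma log_slope0_half_shift : log_slope0 half_shift_thompson = 1.
Proof.
apply: log_slope0P; exists (1 / 8) => [|x x8 /=]; first lra.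
by rewrite expr1z; have [[]|] := half_shiftP x => -[h ->]; lra.
Qed.

Lemma log_slope0_reflect_half_shift :
  log_slope0 (reflect_thompson half_shift_thompson) = 0.
Proof.
apply: log_slope0P; exists (1 / 2) => [|x x2 /=]; first lra.
by rewrite expr0z; have [[]|] := half_shiftP (1 - x) => -[h ->]; lra.
Qed.

(** The supports lie in [0, 1/2] and [1/2, 1] respectively. *)
Lemma half_shift_commute :
  commute half_shift_thompson (reflect_thompson half_shift_thompson).
Proof.
apply: thompson_ext => x /=.
have [x2|x2] := leP x (1 / 2).
  have -> : half_shift (1 - x) = 1 - x by have [[]|] := half_shiftP (1 - x) => -[h ->]; lra.
  rewrite subKr; have fx : half_shift x <= 1 / 2 by have [[]|] := half_shiftP x => -[h ->]; lra.
  by have [[]|] := half_shiftP (1 - half_shift x) => -[h ->]; lra.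
have fx : half_shift (1 - x) <= 1 / 2 by have [[]|] := half_shiftP (1 - x) => -[h ->]; lra.
have -> : half_shift x = x by have [[]|] := half_shiftP x => -[h ->]; lra.
by have [[]|] := half_shiftP (1 - half_shift (1 - x)) => -[h ->]; lra.
Qed.

End Generator.

Theorem theorem5p11 (R : realType) (S : seq (thompson R)) (genS : generates S) :
  sCop R (cayley_graph genS) = (+oo)%E.
Proof.
suff none n : (0 < n)%N -> ~ strong_cop_win (cayley_graph genS) n.
  rewrite /sCop (_ : [set n | _]%classic = set0) ?image_set0 ?ereal_inf0 //.
  by apply/seteqP; split=> // n [n_gt0 /(none n n_gt0)].
pose a := half_shift_thompson R.
(* The mirror image of [a] has slope 1 at 0; mirroring both the function
   [log_slope0] and the element gives the values at the right end. *)
pose phi (b : bool) (f : thompson R) :=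
  log_slope0 (if b then f else reflect_thompson f).
pose g (b : bool) := if b then a else reflect_thompson a.
apply: (@cayley_no_strong_win _ _ genS phi g).
- by move=> [] x y; rewrite /phi ?reflect_thompsonM log_slope0M.
- by case; rewrite /phi /g ?reflect_thompsonK log_slope0_half_shift.
- by case; rewrite /phi /g log_slope0_reflect_half_shift.
exact: half_shift_commute.
Qed.
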